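(* Consider a set $I=(-a,a)$ with $a>0$, or $I=\mathbb{R}$ when $a=\infty$; such sets are symmetric about the point $0$. Let $\mathcal{C}$ be the family of all subsets $S$ of $I$ satisfying the following conditions: (i) for each $S\in\mathcal{C}$, $0\in S$; (ii) for each $S\in\mathcal{C}$ and for each $x\in I$, either $x\in S$ or $-x\in S$. Then for any arbitrary function $y^0$ defined on some given set $S\in\mathcal{C}$, the initial value problem for the functional equation of all even functions, $y(x)=y(-x)$ for $x\in I$, with $y(x)=y^0(x)$ for $x\in S$, has a solution that is uniquely defined on the whole of $I$.
   Context: Functions are real-valued, and $y$ is the unknown function on $I$. A solution of the initial value problem is a function $y$ on $I$ that satisfies the functional equation for all $x\in I$ and agrees with the prescribed initial function $y^0$ on the initial set $S$. *)

(* Defs.v *)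
From HB Require Import structures.
From mathcomp Require Import all_boot all_order all_algebra.
From mathcomp Require Import boolp classical_sets reals constructive_ereal.
Set Implicit Arguments.
Unset Strict Implicit.
Unset Printing Implicit Defensive.
Import Order.TTheory GRing.Theory Num.Theory.
Local Open Scope classical_set_scope.
Local Open Scope ring_scope.

(* For [a = +oo] this is the whole real line. *)
Definition symint (R : realType) (a : \bar R) : set R :=
  [set x : R | (- a < x%:E)%E /\ (x%:E < a)%E].

Lemma symintN (R : realType) (a : \bar R) (x : R) :
  symint a x -> symint a (- x).
Proof. by move=> [ax xa]; split; rewrite EFinN ?lteN2// lteNl. Qed.

Definition symint_opp (R : realType) (a : \bar R) (x : symint a) : symint a :=
  SigSub (mem_set (symintN (set_valP x))).

(* In the second condition "either ... or" is exclusive: if both x and -x could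
   lie in S, initial data with different values there would admit no even
   extension.  The point 0 = -0 is necessarily excepted from it. *)
Definition initial_sets (R : realType) (a : \bar R) : set (set R) :=
  [set S : set R |
    [/\ S `<=` symint a,
        S 0
      & forall x : R, symint a x -> x <> 0 ->
          (S x /\ ~ S (- x)) \/ (~ S x /\ S (- x))]].

Definition even_ivp_solution (R : realType) (a : \bar R) (S : set R)
    (y0 : S -> R) (y : symint a -> R) : Prop :=
  (forall x : symint a, y x = y (symint_opp x)) /\
  (forall (x : symint a) (s : S), \val x = \val s -> y x = y0 s).

(* Main.v *)
Require Import Defs.
From HB Require Import structures.
From mathcomp Require Import all_boot all_order all_algebra.
From mathcomp Require Import boolp classical_sets reals constructive_ereal.
Set Implicit Arguments.
Unset Strict Implicit.
Unset Printing Implicit Defensive.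
Import Order.TTheory GRing.Theory Num.Theory.
Local Open Scope classical_set_scope.
Local Open Scope ring_scope.

(** An even function is a function on the orbits [{x, -x}], and [S] meets each orbit in [I] exactly
    once: at least once by [initial_sets_repr_exists], at most once by [initial_sets_opp_inj].
    Sending [x] to the representative [r x] of its orbit makes [y0 \o r] the only even extension of
    [y0]. *)

Lemma initial_sets_repr_exists (R : realType) (a : \bar R) (S : set R)
    (hS : initial_sets a S) (x : symint a) :
  exists s : S, \val s = \val x \/ \val s = - \val x.
Proof.
have [_ S0 Sx] := hS.
have [x0|xN0] := pselect (\val x = 0).
  by exists (SigSub (mem_set S0)); left.
have [[xS _]|[_ xS]] := Sx _ (set_valP x) xN0.
- by exists (SigSub (mem_set xS)); left.
- by exists (SigSub (mem_set xS)); right.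
Qed.

(** If [s = - t] with [t] nonzero, both [t] and [- t] lie in [S], against exclusivity; at [0] the
    two signs agree. *)
Lemma initial_sets_opp_inj (R : realType) (a : \bar R) (S : set R)
    (hS : initial_sets a S) (s t : S) :
  \val s = \val t \/ \val s = - \val t -> s = t.
Proof.
have [SI _ Sx] := hS => -[/val_inj//|st].
have [t0|tN0] := pselect (\val t = 0).
  by apply: val_inj; rewrite /= st t0 oppr0.
have [tS sS] := (set_valP t, set_valP s).
rewrite st in sS.
by have [[]|[]] := Sx _ (SI _ tS) tN0.
Qed.

Theorem theorem4p1 (R : realType) (a : \bar R) (ha : (0 < a)%E)
    (S : set R) (hS : initial_sets a S) (y0 : S -> R) :
  exists! y : symint a -> R, even_ivp_solution y0 y.
Proof.
have [r rP] := choice (initial_sets_repr_exists hS).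
exists (y0 \o r); split; first split.
(* Evenness: [r x] and [r (- x)] both lie in [{x, -x}], so they agree up to sign and hence
   coincide. *)
- move=> x /=; congr y0; apply: (initial_sets_opp_inj hS).
  have /= := rP (symint_opp x); rewrite opprK.
  by case: (rP x) => -> [] ->; rewrite ?opprK; [right|left|left|right].
- move=> x s xs /=; congr y0; apply: (initial_sets_opp_inj hS).
  by rewrite -xs; exact: rP.
- move=> z [z_even z_init]; apply/funext => x /=.
  (* If [r x] is [- x], evenness moves [z] to that point, where the initial data fix its value. *)
  case: (rP x) => rx; first by rewrite (z_init x (r x)).
  by rewrite z_even (z_init _ (r x)).
Qed.
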